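(* Let $f:\mathbb{R}\to\mathbb{R}$ be real-analytic with $f(0)=0$ and $f'(0)\neq 0$, let $A:=\mathbb{R}\times\{0\}\subset\mathbb{R}^2$ and $B:=\{(t,s)\in\mathbb{R}^2 : s=f(t)\}$, and let $T:=T_{A,B}$ be the Douglas--Rachford operator and $L_T$ the Lyapunov surrogate operator associated with $T$. Let $r_0>0$ and $\eta>1$ be such that $\|y\|\ge \eta\,\|T^2y\|$ for all $y\in\mathcal{B}_{r_0}(0)$, and let $r_1>0$ be such that $T$ is invertible with $T^{-1}(x,z)=(x+zf'(x),\,z-f(x))$ at points of $(-r_1,r_1)\times\mathbb{R}$, in the sense that whenever $y\in\mathbb{R}^2$ and $Ty=(x,z)$ with $|x|<r_1$, one has $y=(x+zf'(x),\,z-f(x))$. Then there exist $r_2,r_3>0$ such that, for every $y^0\in\mathcal{B}_{\min\{r_0,r_1,r_2,r_3\}}(0)$, the sequence defined by $y^{n+1}:=L_T\,y^n$ ($n\ge 0$) converges to $0$ with rate that is never worse than $1/2$-linear and is ultimately quadratic; that is, $\|y^{n+1}\|\le \tfrac12\|y^n\|$ for all $n\ge 0$, and there exist $K>0$ and $N\in\mathbb{N}$ such that $\|y^{n+1}\|\le K\|y^n\|^2$ for all $n\ge N$.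
   Context: Work in $\mathbb{R}^2$ with the Euclidean inner product $\langle\cdot,\cdot\rangle$ and norm $\|\cdot\|$; $\mathcal{B}_r(y)$ is the open ball of radius $r$ centred at $y$. For a nonempty closed set $C\subseteq\mathbb{R}^2$, $P_C:\mathbb{R}^2\to C$ denotes a fixed selector of the nearest-point map, so $P_C(x)\in C$ and $\|P_C(x)-x\|=\inf_{c\in C}\|c-x\|$. The reflection is $R_C:=2P_C-I$, and the Douglas--Rachford operator is $T_{A,B}:=\tfrac12(I+R_B\circ R_A)$ (so $R_A$ is applied first). Lyapunov surrogate operator $L_T$ for $T=T_{A,B}$: given $y\in\mathbb{R}^2$, put $v^0:=y$, $v^1:=T v^0$, $v^2:=T v^1$. If $v^0,v^1,v^2$ are not collinear, $L_T y:=u$, where $u$ is the unique point of the affine span of $\{v^0,v^1,v^2\}$ satisfying $\langle u-v^1,\,v^1-v^0\rangle=0$ and $\langle u-v^2,\,v^2-v^1\rangle=0$. If $v^0,v^1,v^2$ are collinear (including coinciding points), $L_T y:=v^1$. Numbers $r_0,\eta,r_1$ with the stated properties are known to exist for such $f$. *)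

(* Defs.v *)
(* Stdlib reals and Coquelicot. *)
From Stdlib Require Import Reals Lra ClassicalEpsilon.
From Coquelicot Require Import Coquelicot.
Open Scope R_scope.

(* Vectors of the plane are pairs [R * R] with Coquelicot's normed-module
   structure, whose [norm] on a product is the Euclidean one (see [norm_R2]).
   Coquelicot's [ball] on a product is a square, so balls are written with
   [norm] instead. *)
Definition dot (u v : R * R) : R := fst u * fst v + snd u * snd v.

Lemma norm_R2 (u : R * R) : norm u = sqrt (dot u u).
Proof.
  destruct u as [a b]; unfold dot.
  change (norm (a, b)) with (sqrt (Rabs a ^ 2 + Rabs b ^ 2)).
  rewrite !pow2_abs; simpl; f_equal; ring.
Qed.

Definition real_analytic (f : R -> R) : Prop :=
  forall x0 : R, exists (a : nat -> R) (r : R), 0 < r /\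
    forall x : R, Rabs (x - x0) < r -> is_pseries a (x - x0) (f x).

Definition x_axis : R * R -> Prop := fun p => snd p = 0.

Definition graph (f : R -> R) : R * R -> Prop := fun p => snd p = f (fst p).

Definition nearest_selector (C : R * R -> Prop) (P : R * R -> R * R) : Prop :=
  forall x : R * R, C (P x) /\
    is_glb_Rbar (fun d => exists c, C c /\ d = norm (minus c x))
                (Finite (norm (minus (P x) x))).

Definition reflection (P : R * R -> R * R) (x : R * R) : R * R :=
  minus (scal 2 (P x)) x.

(* The operator T_{A,B}, given selectors PA and PB for A and B. *)
Definition douglas_rachford (PA PB : R * R -> R * R) (x : R * R) : R * R :=
  scal (1 / 2) (plus x (reflection PB (reflection PA x))).

Definition collinear (v0 v1 v2 : R * R) : Prop :=
  exists p d : R * R, d <> zero /\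
    (exists t : R, v0 = plus p (scal t d)) /\
    (exists t : R, v1 = plus p (scal t d)) /\
    (exists t : R, v2 = plus p (scal t d)).

Definition in_affine_span (v0 v1 v2 u : R * R) : Prop :=
  exists a b c : R, a + b + c = 1 /\
    u = plus (scal a v0) (plus (scal b v1) (scal c v2)).

Definition surrogate_point (v0 v1 v2 u : R * R) : Prop :=
  in_affine_span v0 v1 v2 u /\
  dot (minus u v1) (minus v1 v0) = 0 /\
  dot (minus u v2) (minus v2 v1) = 0.

(* The [epsilon] below picks the unique surrogate point; existence and
   uniqueness are [surrogate_point_unique]. *)
Definition lyapunov_surrogate (T : R * R -> R * R) (y : R * R) : R * R :=
  let v0 := y in
  let v1 := T v0 in
  let v2 := T v1 in
  if excluded_middle_informative (collinear v0 v1 v2) then v1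
  else epsilon (inhabits zero) (surrogate_point v0 v1 v2).

Lemma not_collinear_det (v0 v1 v2 : R * R) :
  ~ collinear v0 v1 v2 ->
  (fst v1 - fst v0) * (snd v2 - snd v1)
    - (snd v1 - snd v0) * (fst v2 - fst v1) <> 0.
Proof.
  destruct v0 as [a0 b0], v1 as [a1 b1], v2 as [a2 b2]; simpl; intros H D.
  apply H.
  assert (E : forall x y p q c d t : R, x = p + t * c -> y = q + t * d ->
            (x, y) = plus (p, q) (scal t (c, d) : R * R))
    by (intros; subst; reflexivity).
  assert (Z : forall c d : R, c <> 0 \/ d <> 0 -> (c, d) <> (zero : R * R)).
  { intros c d Hcd F; change (zero : R * R) with (0, 0) in F.
    injection F; lra. }
  destruct (Req_dec (a1 - a0) 0) as [Ha | Ha].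
  - destruct (Req_dec (b1 - b0) 0) as [Hb | Hb].
    + destruct (Req_dec (a2 - a1) 0) as [Hc | Hc].
      * exists (a1, b1), (0, 1); split; [apply Z; lra |].
        split; [exists 0 | split; [exists 0 | exists (b2 - b1)]]; apply E; lra.
      * exists (a1, b1), (a2 - a1, b2 - b1).
        split; [apply Z; lra |].
        split; [exists 0 | split; [exists 0 | exists 1]]; apply E; lra.
    + exists (a1, b1), (a1 - a0, b1 - b0).
      split; [apply Z; lra |].
      split; [exists (-1) | split; [exists 0 | exists ((b2 - b1) / (b1 - b0))]];
        apply E; try lra; try (field; lra).
      rewrite Ha in D |- *.
      assert (G : (b1 - b0) * (a2 - a1) = 0) by lra.
      apply Rmult_integral in G; lra.
  - exists (a1, b1), (a1 - a0, b1 - b0).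
    split; [apply Z; lra |].
    split; [exists (-1) | split; [exists 0 | exists ((a2 - a1) / (a1 - a0))]];
      apply E; try lra; try (field; lra).
    apply (Rmult_eq_reg_r (a1 - a0)); [| exact Ha].
    replace ((b1 + (a2 - a1) / (a1 - a0) * (b1 - b0)) * (a1 - a0))
      with (b1 * (a1 - a0) + (a2 - a1) * (b1 - b0)) by (field; exact Ha).
    lra.
Qed.

Lemma surrogate_point_unique (v0 v1 v2 : R * R) :
  ~ collinear v0 v1 v2 -> exists! u : R * R, surrogate_point v0 v1 v2 u.
Proof.
  intros H; apply not_collinear_det in H.
  destruct v0 as [a0 b0], v1 as [a1 b1], v2 as [a2 b2]; simpl in H.
  set (p := a1 - a0) in *; set (q := b1 - b0) in *.
  set (r := a2 - a1) in *; set (s := b2 - b1) in *.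
  set (D := p * s - q * r) in *.
  set (k := r * r + s * s).
  exists (a1 - q * k / D, b1 + p * k / D); split.
  - split; [| split].
    + (* u = v1 + alpha (v1 - v0) + beta (v2 - v1) *)
      set (al := (- q * s - p * r) * k / (D * D)).
      set (be := (p * p + q * q) * k / (D * D)).
      exists (- al), (1 + al - be), be; split; [ring |].
      change ((a1 - q * k / D, b1 + p * k / D)
              = (- al * a0 + ((1 + al - be) * a1 + be * a2),
                 - al * b0 + ((1 + al - be) * b1 + be * b2))).
      f_equal.
      * replace (- al * a0 + ((1 + al - be) * a1 + be * a2))
          with (a1 + al * p + be * r) by (unfold p, r; ring).
        unfold al, be; field_simplify_eq; [unfold D; ring | exact H].
      * replace (- al * b0 + ((1 + al - be) * b1 + be * b2))
          with (b1 + al * q + be * s) by (unfold q, s; ring).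
        unfold al, be; field_simplify_eq; [unfold D; ring | exact H].
    + change ((a1 - q * k / D + - a1) * p + (b1 + p * k / D + - b1) * q = 0).
      field; exact H.
    + change ((a1 - q * k / D + - a2) * r + (b1 + p * k / D + - b2) * s = 0).
      replace (a1 - q * k / D + - a2) with (- q * k / D - r)
        by (unfold r; field; exact H).
      replace (b1 + p * k / D + - b2) with (p * k / D - s)
        by (unfold s; field; exact H).
      unfold k; field_simplify_eq; [unfold D; ring | exact H].
  - intros [x y] [_ [H1 H2]].
    change ((x + - a1) * p + (y + - b1) * q = 0) in H1.
    change ((x + - a2) * r + (y + - b2) * s = 0) in H2.
    assert (H3 : (x - a1) * r + (y - b1) * s = k) by (unfold k, r, s in *; lra).
    f_equal; apply (Rmult_eq_reg_r D); try exact H.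
    + replace ((a1 - q * k / D) * D) with (a1 * D - q * k) by (field; exact H).
      rewrite <- H3; unfold D.
      assert (G : ((x + - a1) * p + (y + - b1) * q) * s = 0)
        by (rewrite H1; ring); lra.
    + replace ((b1 + p * k / D) * D) with (b1 * D + p * k) by (field; exact H).
      rewrite <- H3; unfold D.
      assert (G : ((x + - a1) * p + (y + - b1) * q) * r = 0)
        by (rewrite H1; ring); lra.
Qed.

(* Main.v *)
Require Import Defs.
From Stdlib Require Import Reals.
From Coquelicot Require Import Coquelicot.
From Stdlib Require Import Lra Lia ClassicalEpsilon.
Open Scope R_scope.

(** For the linear function [t |-> m t] the operator [T] is a rotation followed
    by a contraction, with inverse [v |-> v + m J v] where [J (x, z) = (z, -x)].
    Each step of an orbit is then orthogonal to the point at which it arrives,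
    so the two lines that define the surrogate point both pass through the
    origin: the surrogate reaches the solution at once.  For an analytic [f] of
    slope [m] at 0 this picture is perturbed by the Taylor remainders of [f],
    and the point is to see that the error is quadratic.

    Everything is expressed in terms of [v = T (T y)], because the formula for
    the inverse of [T] gives the two earlier points explicitly: [T y = w v] and
    [y = w (w v)], where [w] is [backward f].  With [s v = w v - v], which is
    [back_step f v], the surrogate point [u] solves
      [<u, s (w v)> = <w v, s (w v)>]  and  [<u, s v> = <v, s v>].
    Three estimates as [v] tends to 0 determine the size of [u].
    - The steps [s] are of order 1 ([fst_back_step_big_o],
      [snd_back_step_big_o]).
    - The right-hand sides are of order 3: their quadratic part vanishes by the
      orthogonality above ([dot_back_step_big_o]).
    - The determinant of the system is [m ^ 3 * norm v ^ 2] up to an error of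
      order 3 ([cross_back_steps_big_o]), hence at least a positive multiple of
      [norm v ^ 2].
    By Cramer's rule the numerators are of order [3 + 1 = 4] and the denominator
    is of exact order 2, so [u] is of order 2 in [v]
    ([surrogate_point_quadratic]).  As [T o T] does not increase the norm near
    0, the same bound holds in terms of [y].  The lower bound on the determinant
    also shows that the three points are collinear only when all vanish, and
    then the surrogate is 0.  Finally, a bound [K * norm y ^ 2] is at most
    [norm y / 2] on the ball of radius [1 / (2 * K)], which makes the ball
    invariant and gives both rates from the first iteration on. *)

(** * Functions of order k at the origin *)

(** The order is taken over an arbitrary normed space so that functions of one
    variable and of a point of the plane share one calculus.  Asking for [0 < c]
    spares case distinctions when radii are divided by [c]. *)
Definition big_o {V : NormedModule R_AbsRing} (k : nat) (g : V -> R) : Prop :=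
  exists c d : R, 0 < c /\ 0 < d /\
    forall v : V, norm v < d -> Rabs (g v) <= c * norm v ^ k.

Lemma big_o_ext {V : NormedModule R_AbsRing} (k : nat) (g h : V -> R) :
  (forall v, g v = h v) -> big_o k g -> big_o k h.
Proof.
  intros E (c & d & Hc & Hd & H); exists c, d; repeat split; auto.
  intros v Hv; rewrite <- E; auto.
Qed.

Lemma big_o_const {V : NormedModule R_AbsRing} (m : R) :
  big_o 0 (fun _ : V => m).
Proof.
  exists (Rabs m + 1), 1; pose proof (Rabs_pos m).
  repeat split; try lra; intros; simpl; lra.
Qed.

Lemma big_o_norm {V : NormedModule R_AbsRing} : big_o 1 (norm (V := V)).
Proof.
  exists 1, 1; repeat split; try lra; intros v _.
  rewrite Rabs_pos_eq by apply norm_ge_0; simpl; lra.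
Qed.

Lemma big_o_le {V : NormedModule R_AbsRing} (k : nat) (g h : V -> R) :
  (forall v, Rabs (g v) <= Rabs (h v)) -> big_o k h -> big_o k g.
Proof.
  intros E (c & d & Hc & Hd & H); exists c, d; repeat split; auto.
  intros v Hv; eapply Rle_trans; [apply E | auto].
Qed.

Lemma big_o_plus {V : NormedModule R_AbsRing} (k : nat) (g h : V -> R) :
  big_o k g -> big_o k h -> big_o k (fun v => g v + h v).
Proof.
  intros (c & d & Hc & Hd & H) (c' & d' & Hc' & Hd' & H').
  exists (c + c'), (Rmin d d'); repeat split; try lra.
  - now apply Rmin_pos.
  - intros v Hv.
    specialize (H v (Rlt_le_trans _ _ _ Hv (Rmin_l _ _))).
    specialize (H' v (Rlt_le_trans _ _ _ Hv (Rmin_r _ _))).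
    pose proof (Rabs_triang (g v) (h v)); lra.
Qed.

Lemma big_o_opp {V : NormedModule R_AbsRing} (k : nat) (g : V -> R) :
  big_o k g -> big_o k (fun v => - g v).
Proof. apply big_o_le; intros v; rewrite Rabs_Ropp; lra. Qed.

Lemma big_o_minus {V : NormedModule R_AbsRing} (k : nat) (g h : V -> R) :
  big_o k g -> big_o k h -> big_o k (fun v => g v - h v).
Proof. intros; apply big_o_plus, big_o_opp; assumption. Qed.

Lemma big_o_mult {V : NormedModule R_AbsRing} (j k : nat) (g h : V -> R) :
  big_o j g -> big_o k h -> big_o (j + k) (fun v => g v * h v).
Proof.
  intros (c & d & Hc & Hd & H) (c' & d' & Hc' & Hd' & H').
  exists (c * c'), (Rmin d d'); repeat split.
  - now apply Rmult_lt_0_compat.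
  - now apply Rmin_pos.
  - intros v Hv.
    specialize (H v (Rlt_le_trans _ _ _ Hv (Rmin_l _ _))).
    specialize (H' v (Rlt_le_trans _ _ _ Hv (Rmin_r _ _))).
    rewrite Rabs_mult, pow_add.
    replace (c * c' * (norm v ^ j * norm v ^ k))
      with ((c * norm v ^ j) * (c' * norm v ^ k)) by ring.
    apply Rmult_le_compat; auto using Rabs_pos.
Qed.

Lemma big_o_weaken {V : NormedModule R_AbsRing} (j k : nat) (g : V -> R) :
  (j <= k)%nat -> big_o k g -> big_o j g.
Proof.
  intros Hjk (c & d & Hc & Hd & H); exists c, (Rmin d 1).
  repeat split; auto; [apply Rmin_pos; lra |]; intros v Hv.
  specialize (H v (Rlt_le_trans _ _ _ Hv (Rmin_l _ _))).
  pose proof (Rlt_le_trans _ _ _ Hv (Rmin_r _ _)) as Hv1.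
  pose proof (norm_ge_0 v) as Hv0.
  eapply Rle_trans; [exact H |]; apply Rmult_le_compat_l; [lra |].
  replace k with (j + (k - j))%nat by lia; rewrite pow_add.
  rewrite <- (Rmult_1_r (norm v ^ j)) at 2.
  apply Rmult_le_compat_l; [now apply pow_le |].
  rewrite <- (pow1 (k - j)); apply pow_incr; lra.
Qed.

(** The order of [g] survives any substitution that is at most linear in size;
    this transports estimates at [v] to estimates at [backward f v]. *)
Lemma big_o_comp {U V : NormedModule R_AbsRing} (k : nat)
    (g : V -> R) (W : U -> V) :
  big_o 1 (fun u => norm (W u)) -> big_o k g -> big_o k (fun u => g (W u)).
Proof.
  intros (c & d & Hc & Hd & H) (c' & d' & Hc' & Hd' & H').
  exists (c' * c ^ k), (Rmin d (d' / c)); repeat split.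
  - apply Rmult_lt_0_compat; auto; now apply pow_lt.
  - apply Rmin_pos; auto; now apply Rdiv_lt_0_compat.
  - intros u Hu.
    specialize (H u (Rlt_le_trans _ _ _ Hu (Rmin_l _ _))).
    pose proof (Rlt_le_trans _ _ _ Hu (Rmin_r _ _)) as Hu'.
    rewrite Rabs_pos_eq, pow_1 in H by apply norm_ge_0.
    assert (HW : norm (W u) < d').
    { eapply Rle_lt_trans; [exact H |].
      apply (Rmult_lt_compat_l c) in Hu'; auto.
      replace (c * (d' / c)) with d' in Hu' by (field; lra); exact Hu'. }
    eapply Rle_trans; [apply H', HW |].
    rewrite Rmult_assoc, <- Rpow_mult_distr.
    apply Rmult_le_compat_l; [lra |].
    apply pow_incr; split; [apply norm_ge_0 | exact H].
Qed.

Lemma abs_fst_le_norm (v : R * R) : Rabs (fst v) <= norm v.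
Proof.
  destruct v as [x z].
  eapply Rle_trans; [apply (Rmax_l (norm x) (norm z)) | apply norm_prod].
Qed.

Lemma abs_snd_le_norm (v : R * R) : Rabs (snd v) <= norm v.
Proof.
  destruct v as [x z].
  eapply Rle_trans; [apply (Rmax_r (norm x) (norm z)) | apply norm_prod].
Qed.

Lemma norm_sqr (v : R * R) : norm v ^ 2 = dot v v.
Proof. rewrite norm_R2; apply pow2_sqrt; unfold dot; nra. Qed.

Lemma norm_le_abs_plus (v : R * R) :
  norm v <= Rabs (fst v) + Rabs (snd v).
Proof.
  pose proof (Rabs_pos (fst v)); pose proof (Rabs_pos (snd v)).
  apply Rsqr_incr_0_var; [| lra]; rewrite !Rsqr_pow2, norm_sqr; unfold dot.
  pose proof (pow2_abs (fst v)); pose proof (pow2_abs (snd v)); nra.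
Qed.

Lemma big_o_fst : big_o 1 (fst : R * R -> R).
Proof.
  refine (big_o_le 1 _ _ _ big_o_norm); intros v.
  rewrite (Rabs_pos_eq (norm v)) by apply norm_ge_0; apply abs_fst_le_norm.
Qed.

Lemma big_o_snd : big_o 1 (snd : R * R -> R).
Proof.
  refine (big_o_le 1 _ _ _ big_o_norm); intros v.
  rewrite (Rabs_pos_eq (norm v)) by apply norm_ge_0; apply abs_snd_le_norm.
Qed.

Lemma big_o_pair {V : NormedModule R_AbsRing} (k : nat) (g h : V -> R) :
  big_o k g -> big_o k h -> big_o k (fun v => norm (g v, h v)).
Proof.
  intros Hg Hh.
  assert (A : forall l : V -> R, big_o k l -> big_o k (fun v => Rabs (l v)))
    by (intros l; apply big_o_le; intros; rewrite Rabs_Rabsolu; lra).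
  refine (big_o_le _ _ _ _ (big_o_plus _ _ _ (A _ Hg) (A _ Hh))); intros v.
  rewrite Rabs_pos_eq by apply norm_ge_0.
  eapply Rle_trans; [apply norm_le_abs_plus | apply Rle_abs].
Qed.

Lemma big_o_along_fst (k : nat) (g : R -> R) :
  big_o k g -> big_o k (fun v : R * R => g (fst v)).
Proof.
  apply (big_o_comp k g (fst : R * R -> R)).
  refine (big_o_le _ _ _ _ big_o_fst); intros v.
  change (Rabs (Rabs (fst v)) <= Rabs (fst v)).
  rewrite Rabs_Rabsolu; lra.
Qed.

(** * Taylor remainders of an analytic function *)

Lemma is_derive_big_o (g : R -> R) (l : R) :
  is_derive g 0 l -> big_o 1 (fun t : R => g t - g 0).
Proof.
  intros H; apply is_derive_Reals in H.
  destruct (H 1 Rlt_0_1) as [d Hd].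
  exists (Rabs l + 1), d; pose proof (Rabs_pos l).
  repeat split; [lra | apply cond_pos |]; intros t Ht.
  change (norm t) with (Rabs t) in *; rewrite pow_1.
  destruct (Req_dec t 0) as [-> | Ht0].
  - rewrite Rminus_eq_0, Rabs_R0; lra.
  - specialize (Hd t Ht0 Ht); rewrite Rplus_0_l in Hd.
    replace (g t - g 0) with (((g t - g 0) / t - l) * t + l * t)
      by (field; exact Ht0).
    eapply Rle_trans; [apply Rabs_triang |]; rewrite !Rabs_mult.
    pose proof (Rabs_pos t); nra.
Qed.

(** All that is used of analyticity: the expansion at 0 can be differentiated
    term by term, twice at 0. *)
Lemma real_analytic_derivatives (f : R -> R) :
  real_analytic f ->
  exists d : R, 0 < d /\ (forall t, Rabs t < d -> ex_derive f t) /\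
    ex_derive (Derive f) 0.
Proof.
  intros Hf; destruct (Hf 0) as (a & r & Hr & Ha).
  assert (Ha' : forall t, Rabs t < r -> is_pseries a t (f t)).
  { intros t Ht; specialize (Ha t); rewrite Rminus_0_r in Ha; auto. }
  assert (Hcv : forall t, Rabs t < r / 2 -> Rbar_lt (Rabs t) (CV_radius a)).
  { intros t Ht; apply Rbar_lt_le_trans with (Rabs (r / 2)).
    - simpl; rewrite (Rabs_pos_eq (r / 2)); lra.
    (* The terms of a series that converges at [r / 2] tend to 0 there, so this
       point is not outside the closed disk of convergence. *)
    - apply Rbar_not_lt_le; intros Hout.
      apply CV_disk_outside in Hout; apply Hout.
      apply ex_series_lim_0, ex_pseries_R.
      exists (f (r / 2)); apply Ha'; rewrite Rabs_pos_eq; lra. }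
  assert (Hloc : forall t, Rabs t < r / 2 ->
            locally t (fun s : R => Rabs s < r / 2)).
  { intros t Ht; apply (continuous_Rabs t (fun x => x < r / 2)).
    now apply open_lt. }
  assert (Hd : forall t, Rabs t < r / 2 ->
            is_derive f t (PSeries (PS_derive a) t)).
  { intros t Ht; apply (is_derive_ext_loc (PSeries a)).
    - generalize (Hloc t Ht); apply filter_imp; intros s Hs.
      apply is_pseries_unique, Ha'; lra.
    - apply is_derive_PSeries; auto. }
  exists (r / 2); split; [lra |]; split.
  - intros t Ht; eexists; eauto.
  - assert (H0 : Rabs 0 < r / 2) by (rewrite Rabs_R0; lra).
    apply (ex_derive_ext_loc (PSeries (PS_derive a))).
    + generalize (Hloc 0 H0); apply filter_imp; intros s Hs.
      symmetry; apply is_derive_unique; auto.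
    + apply ex_derive_PSeries; rewrite CV_radius_derive; auto.
Qed.

Lemma analytic_derive_big_o (f : R -> R) :
  real_analytic f -> big_o 1 (fun t : R => Derive f t - Derive f 0).
Proof.
  intros Hf; destruct (real_analytic_derivatives f Hf) as (_ & _ & _ & [l Hl]).
  exact (is_derive_big_o _ _ Hl).
Qed.

(** The mean value theorem trades the remainder for [Derive f s - Derive f 0] at
    a closer point [s], which is of order 1, times [t]. *)
Lemma analytic_tangent_big_o (f : R -> R) :
  real_analytic f -> f 0 = 0 ->
  big_o 2 (fun t : R => f t - Derive f 0 * t).
Proof.
  intros Hf f0; destruct (real_analytic_derivatives f Hf) as (d & Hd & He & _).
  destruct (analytic_derive_big_o f Hf) as (c & d' & Hc & Hd' & H).
  exists c, (Rmin d d'); repeat split; auto; [now apply Rmin_pos |].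
  intros t Ht; change (norm t) with (Rabs t) in *.
  pose proof (Rlt_le_trans _ _ _ Ht (Rmin_l _ _)) as Ht1.
  pose proof (Rlt_le_trans _ _ _ Ht (Rmin_r _ _)) as Ht2.
  assert (Hseg : forall s, Rmin 0 t <= s <= Rmax 0 t -> Rabs s <= Rabs t).
  { intros s; unfold Rmin, Rmax, Rabs.
    destruct (Rle_dec 0 t), (Rcase_abs s), (Rcase_abs t); lra. }
  destruct (MVT_gen f 0 t (Derive f)) as (s & Hs & E).
  - intros s Hs; apply Derive_correct, He.
    eapply Rle_lt_trans; [apply Hseg | exact Ht1].
    split; apply Rlt_le, Hs.
  - intros s Hs; apply continuity_pt_filterlim.
    apply (ex_derive_continuous (K := R_AbsRing) (V := R_NormedModule) f s), He.
    eapply Rle_lt_trans; [now apply Hseg | exact Ht1].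
  - apply Hseg in Hs.
    replace (f t - Derive f 0 * t) with ((Derive f s - Derive f 0) * t)
      by (rewrite f0, !Rminus_0_r in E; rewrite E; ring).
    specialize (H s (Rle_lt_trans _ _ _ Hs Ht2)).
    change (norm s) with (Rabs s) in H; rewrite pow_1 in H.
    rewrite Rabs_mult; pose proof (Rabs_pos t).
    apply Rle_trans with (c * Rabs s * Rabs t);
      [now apply Rmult_le_compat_r |].
    simpl; rewrite Rmult_1_r, <- Rmult_assoc.
    apply Rmult_le_compat_r; [assumption |]; apply Rmult_le_compat_l; lra.
Qed.

(** * The backward orbit and the surrogate point *)

Definition cross (u v : R * R) : R := fst u * snd v - snd u * fst v.

(** The formula for the inverse of the Douglas--Rachford operator. *)
Definition backward (f : R -> R) (v : R * R) : R * R :=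
  (fst v + snd v * Derive f (fst v), snd v - f (fst v)).

Definition back_step (f : R -> R) (v : R * R) : R * R :=
  (snd v * Derive f (fst v), - f (fst v)).

(** The deviation of [back_step f v] from [m J v], where [m = Derive f 0] and
    [J (x, z) = (z, -x)], which is its value for a linear function. *)
Definition step_error (f : R -> R) (v : R * R) : R * R :=
  (snd v * (Derive f (fst v) - Derive f 0), Derive f 0 * fst v - f (fst v)).

Lemma fst_step_error_big_o (f : R -> R) :
  real_analytic f -> big_o 2 (fun v => fst (step_error f v)).
Proof.
  intros Hf; apply (big_o_mult 1 1); [apply big_o_snd |].
  apply (big_o_along_fst 1 (fun t => Derive f t - Derive f 0)).
  now apply analytic_derive_big_o.
Qed.

Lemma snd_step_error_big_o (f : R -> R) :
  real_analytic f -> f 0 = 0 -> big_o 2 (fun v => snd (step_error f v)).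
Proof.
  intros Hf f0.
  apply (big_o_ext _ (fun v : R * R => - (f (fst v) - Derive f 0 * fst v)));
    [intros v; simpl; ring |].
  apply big_o_opp, (big_o_along_fst 2 (fun t => f t - Derive f 0 * t)).
  now apply analytic_tangent_big_o.
Qed.

Lemma fst_back_step_big_o (f : R -> R) :
  real_analytic f -> big_o 1 (fun v => fst (back_step f v)).
Proof.
  intros Hf.
  apply (big_o_ext _ (fun v => Derive f 0 * snd v + fst (step_error f v)));
    [intros v; simpl; ring |].
  apply big_o_plus;
    [| apply (big_o_weaken 1 2); auto using fst_step_error_big_o].
  apply (big_o_mult 0 1); auto using big_o_const, big_o_snd.
Qed.

Lemma snd_back_step_big_o (f : R -> R) :
  real_analytic f -> f 0 = 0 -> big_o 1 (fun v => snd (back_step f v)).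
Proof.
  intros Hf f0.
  apply (big_o_ext _ (fun v => snd (step_error f v) - Derive f 0 * fst v));
    [intros v; simpl; ring |].
  apply big_o_minus;
    [apply (big_o_weaken 1 2); auto using snd_step_error_big_o |].
  apply (big_o_mult 0 1); auto using big_o_const, big_o_fst.
Qed.

Lemma backward_big_o (f : R -> R) :
  real_analytic f -> f 0 = 0 -> big_o 1 (fun v => norm (backward f v)).
Proof.
  intros Hf f0.
  apply (big_o_ext _ (fun v : R * R =>
    norm (fst v + fst (back_step f v), snd v + snd (back_step f v))));
    [reflexivity |].
  apply big_o_pair; apply big_o_plus;
    auto using big_o_fst, big_o_snd, fst_back_step_big_o, snd_back_step_big_o.
Qed.

(** The linear part [m J v] of the step is orthogonal to [v], so only the error,
    of order 2, contributes. *)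
Lemma dot_back_step_big_o (f : R -> R) :
  real_analytic f -> f 0 = 0 -> big_o 3 (fun v => dot v (back_step f v)).
Proof.
  intros Hf f0.
  apply (big_o_ext _ (fun v : R * R =>
    fst v * fst (step_error f v) + snd v * snd (step_error f v)));
    [intros v; unfold dot; simpl; ring |].
  apply big_o_plus; apply (big_o_mult 1 2);
    auto using big_o_fst, big_o_snd, fst_step_error_big_o, snd_step_error_big_o.
Qed.

(** Write [s v = m J v + e v] for the step and [w v = v + s v].  Then
    [cross (s (w v)) (s v) = cross (e (w v)) (s v) + m * cross (J (w v)) (e v)
     + m ^ 2 * cross (w v) v], because [J] preserves [cross]; and
    [cross (w v) v = m * norm v ^ 2 + cross (e v) v].  Every term that contains
    [e] is of order 3. *)
Lemma cross_back_steps_big_o (f : R -> R) :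
  real_analytic f -> f 0 = 0 ->
  big_o 3 (fun v => cross (back_step f (backward f v)) (back_step f v)
                    - Derive f 0 ^ 3 * norm v ^ 2).
Proof.
  intros Hf f0.
  set (m := Derive f 0); set (w := backward f).
  set (s := back_step f); set (e := step_error f).
  assert (Ow : forall k (g : R * R -> R), big_o k g -> big_o k (fun v => g (w v)))
    by (intros k g; apply (big_o_comp k g w), backward_big_o; auto).
  assert (E1 : big_o 2 (fun v => fst (e v))) by now apply fst_step_error_big_o.
  assert (E2 : big_o 2 (fun v => snd (e v))) by now apply snd_step_error_big_o.
  pose proof (Ow _ _ E1) as E1w; pose proof (Ow _ _ E2) as E2w.
  pose proof (Ow _ _ big_o_fst) as W1; pose proof (Ow _ _ big_o_snd) as W2.
  pose proof (fst_back_step_big_o f Hf) as S1.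
  pose proof (snd_back_step_big_o f Hf f0) as S2.
  assert (M : forall g : R * R -> R, big_o 3 g -> big_o 3 (fun v => m * g v))
    by (intros g; apply (big_o_mult 0 3), big_o_const).
  apply (big_o_ext _ (fun v : R * R =>
    (fst (e (w v)) * snd (s v) - snd (e (w v)) * fst (s v))
    + (m * (fst (w v) * fst (e v) + snd (w v) * snd (e v))
       + m * (m * (fst (e v) * snd v - snd (e v) * fst v))))).
  - intros v; rewrite norm_sqr; unfold cross, dot, s, e, w; simpl; fold m; ring.
  - apply big_o_plus; [| apply big_o_plus].
    + apply big_o_minus; now apply (big_o_mult 2 1).
    + apply M, big_o_plus; now apply (big_o_mult 1 2).
    + apply M, M, big_o_minus; apply (big_o_mult 2 1);
        auto using big_o_fst, big_o_snd.
Qed.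

Lemma cross_back_steps_lower_bound (f : R -> R) :
  real_analytic f -> f 0 = 0 -> Derive f 0 <> 0 ->
  exists c d : R, 0 < c /\ 0 < d /\ forall v : R * R, norm v < d ->
    c * norm v ^ 2
      <= Rabs (cross (back_step f (backward f v)) (back_step f v)).
Proof.
  intros Hf f0 Hm.
  destruct (cross_back_steps_big_o f Hf f0) as (c & d & Hc & Hd & H).
  set (m := Derive f 0) in *.
  assert (Hm3 : 0 < Rabs (m ^ 3)) by (apply Rabs_pos_lt, pow_nonzero, Hm).
  exists (Rabs (m ^ 3) / 2), (Rmin d (Rabs (m ^ 3) / (2 * c))).
  repeat split; [lra | apply Rmin_pos; auto; apply Rdiv_lt_0_compat; lra |].
  intros v Hv.
  specialize (H v (Rlt_le_trans _ _ _ Hv (Rmin_l _ _))).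
  pose proof (Rlt_le_trans _ _ _ Hv (Rmin_r _ _)) as Hv'.
  apply (Rmult_lt_compat_l c) in Hv'; auto.
  replace (c * (Rabs (m ^ 3) / (2 * c))) with (Rabs (m ^ 3) / 2) in Hv'
    by (field; lra).
  set (D := cross _ _) in *.
  pose proof (Rabs_triang_inv (m ^ 3 * norm v ^ 2) (m ^ 3 * norm v ^ 2 - D))
    as Htri.
  replace (m ^ 3 * norm v ^ 2 - (m ^ 3 * norm v ^ 2 - D)) with D in Htri by ring.
  rewrite Rabs_minus_sym in H.
  rewrite Rabs_mult, (Rabs_pos_eq (norm v ^ 2)) in Htri by apply pow2_ge_0.
  assert (c * norm v ^ 3 <= Rabs (m ^ 3) / 2 * norm v ^ 2).
  { replace (c * norm v ^ 3) with (c * norm v * norm v ^ 2) by ring.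
    apply Rmult_le_compat_r; [apply pow2_ge_0 | lra]. }
  lra.
Qed.

Lemma collinear_cross (v0 v1 v2 : R * R) :
  collinear v0 v1 v2 -> cross (minus v0 v1) (minus v1 v2) = 0.
Proof.
  intros (p & q & _ & [t0 ->] & [t1 ->] & [t2 ->]).
  destruct p as [p p'], q as [q q']; unfold cross.
  change (((p + t0 * q) + - (p + t1 * q)) * ((p' + t1 * q') + - (p' + t2 * q'))
    - ((p' + t0 * q') + - (p' + t1 * q')) * ((p + t1 * q) + - (p + t2 * q)) = 0).
  ring.
Qed.

Lemma backward_minus (f : R -> R) (v : R * R) :
  minus (backward f v) v = back_step f v.
Proof.
  destruct v as [x z].
  change ((x + z * Derive f x + - x, z - f x + - z)
          = (z * Derive f x, - f x)).
  f_equal; ring.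
Qed.

Lemma cramer (u a b : R * R) :
  (cross a b * fst u = dot u a * snd b - dot u b * snd a) /\
  (cross a b * snd u = dot u b * fst a - dot u a * fst b).
Proof. unfold cross, dot; split; ring. Qed.

Lemma surrogate_point_dot (v0 v1 v2 u : R * R) :
  surrogate_point v0 v1 v2 u ->
  dot u (minus v0 v1) = dot v1 (minus v0 v1) /\
  dot u (minus v1 v2) = dot v2 (minus v1 v2).
Proof.
  destruct v0 as [a0 b0], v1 as [a1 b1], v2 as [a2 b2], u as [x y].
  intros (_ & H1 & H2).
  change ((x + - a1) * (a1 + - a0) + (y + - b1) * (b1 + - b0) = 0) in H1.
  change ((x + - a2) * (a2 + - a1) + (y + - b2) * (b2 + - b1) = 0) in H2.
  split.
  - change (x * (a0 + - a1) + y * (b0 + - b1)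
            = a1 * (a0 + - a1) + b1 * (b0 + - b1)); lra.
  - change (x * (a1 + - a2) + y * (b1 + - b2)
            = a2 * (a1 + - a2) + b2 * (b1 + - b2)); lra.
Qed.

(** Cramer's rule on the system solved by [u]: numerators of order 4 over a
    determinant of order exactly 2. *)
Lemma surrogate_point_quadratic (f : R -> R) :
  real_analytic f -> f 0 = 0 -> Derive f 0 <> 0 ->
  exists K d : R, 0 < K /\ 0 < d /\ forall v u : R * R,
    norm v < d -> v <> zero ->
    surrogate_point (backward f (backward f v)) (backward f v) v u ->
    norm u <= K * norm v ^ 2.
Proof.
  intros Hf f0 Hm.
  destruct (cross_back_steps_lower_bound f Hf f0 Hm)
    as (c & d & Hc & Hd & H).
  pose (s := back_step f); pose (w := backward f).
  assert (Ow : forall k (g : R * R -> R), big_o k g -> big_o k (fun v => g (w v)))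
    by (intros k g; apply (big_o_comp k g w), backward_big_o; auto).
  pose proof (dot_back_step_big_o f Hf f0) as Odot.
  pose proof (fst_back_step_big_o f Hf) as Ofst.
  pose proof (snd_back_step_big_o f Hf f0) as Osnd.
  pose proof (Ow _ _ Odot) as Odot'.
  pose proof (Ow _ _ Ofst) as Ofst'.
  pose proof (Ow _ _ Osnd) as Osnd'.
  assert (N : big_o 4 (fun v => norm
    (dot (w v) (s (w v)) * snd (s v) - dot v (s v) * snd (s (w v)),
     dot v (s v) * fst (s (w v)) - dot (w v) (s (w v)) * fst (s v)))).
  { apply big_o_pair; apply big_o_minus; apply (big_o_mult 3 1); assumption. }
  destruct N as (c' & d' & Hc' & Hd' & N).
  exists (c' / c), (Rmin d d'); repeat split;
    [now apply Rdiv_lt_0_compat | now apply Rmin_pos |].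
  intros v u Hv Hv0 Hu.
  specialize (H v (Rlt_le_trans _ _ _ Hv (Rmin_l _ _))).
  specialize (N v (Rlt_le_trans _ _ _ Hv (Rmin_r _ _))).
  apply surrogate_point_dot in Hu; rewrite !backward_minus in Hu.
  fold w s in Hu, H; destruct Hu as [Hu1 Hu2].
  destruct (cramer u (s (w v)) (s v)) as [C1 C2].
  rewrite Hu1, Hu2 in C1, C2; rewrite <- C1, <- C2 in N.
  set (D := cross _ _) in *.
  change (D * fst u, D * snd u) with (scal D (fst u, snd u)) in N.
  rewrite <- surjective_pairing, Rabs_pos_eq in N by apply norm_ge_0.
  assert (HD : norm (scal D u) = Rabs D * norm u).
  { rewrite !norm_R2, <- sqrt_Rsqr_abs, <- sqrt_mult_alt by apply Rle_0_sqr.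
    f_equal; destruct u as [x y]; unfold dot, Rsqr.
    change (D * x * (D * x) + D * y * (D * y) = D * D * (x * x + y * y)); ring. }
  rewrite HD in N.
  assert (Hpos : 0 < norm v).
  { destruct (Rle_lt_or_eq_dec _ _ (norm_ge_0 v)) as [h | h]; auto.
    symmetry in h; apply norm_eq_zero in h; contradiction. }
  assert (P2 : 0 < norm v ^ 2) by now apply pow_lt.
  apply (Rmult_le_reg_l (c * norm v ^ 2)); [now apply Rmult_lt_0_compat |].
  replace (c * norm v ^ 2 * (c' / c * norm v ^ 2)) with (c' * norm v ^ 4)
    by (field; lra).
  eapply Rle_trans; [| exact N].
  apply Rmult_le_compat_r; [apply norm_ge_0 | exact H].
Qed.

(** * One iteration, and the iterates *)

Lemma backward_zero (f : R -> R) : f 0 = 0 -> backward f zero = zero.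
Proof.
  intros f0.
  change ((0 + 0 * Derive f 0, 0 - f 0) = (0, 0) :> R * R).
  rewrite f0; f_equal; ring.
Qed.

(** The radius ensures that [T y] and [T (T y)] both lie in the strip where [T]
    can be inverted, so that [T y] and [y] are the first two points of the
    backward orbit of [T (T y)]. *)
Lemma lyapunov_surrogate_quadratic (f : R -> R) (T : R * R -> R * R)
    (r0 r1 : R) :
  real_analytic f -> f 0 = 0 -> Derive f 0 <> 0 -> 0 < r1 ->
  (forall y, norm y < r0 -> norm (T (T y)) <= norm y) ->
  (forall y, Rabs (fst (T y)) < r1 -> y = backward f (T y)) ->
  exists K r2 : R, 0 < K /\ 0 < r2 /\ forall y,
    norm y < r0 -> norm y < r2 ->
    norm (lyapunov_surrogate T y) <= K * norm y ^ 2.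
Proof.
  intros Hf f0 Hm Hr1 Hdec Hinv.
  destruct (surrogate_point_quadratic f Hf f0 Hm) as (K & d & HK & Hd & Hu).
  destruct (cross_back_steps_lower_bound f Hf f0 Hm)
    as (c & d1 & Hc & Hd1 & Hcross).
  destruct (backward_big_o f Hf f0) as (b & d2 & Hb & Hd2 & Hback).
  exists K, (Rmin (Rmin d d1) (Rmin d2 (Rmin r1 (r1 / b)))).
  split; [exact HK |]; split.
  { repeat apply Rmin_pos; auto; now apply Rdiv_lt_0_compat. }
  intros y Hy0 Hy.
  set (v := T (T y)).
  assert (Hv : norm v <= norm y) by now apply Hdec.
  pose proof (Rle_lt_trans _ _ _ Hv Hy) as Hvr.
  apply Rmin_Rgt in Hvr; destruct Hvr as [Ha Hbc].
  apply Rmin_Rgt in Ha; destruct Ha as [Hvd Hvd1].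
  apply Rmin_Rgt in Hbc; destruct Hbc as [Hvd2 Hbc].
  apply Rmin_Rgt in Hbc; destruct Hbc as [Hvr1 Hvb].
  apply Rgt_lt in Hvd, Hvd1, Hvd2, Hvr1, Hvb.
  assert (E1 : T y = backward f v).
  { apply Hinv; eapply Rle_lt_trans; [apply abs_fst_le_norm | exact Hvr1]. }
  assert (E0 : y = backward f (T y)).
  { apply Hinv; eapply Rle_lt_trans; [apply abs_fst_le_norm |].
    specialize (Hback v Hvd2).
    rewrite Rabs_pos_eq, pow_1 in Hback by apply norm_ge_0.
    rewrite E1; eapply Rle_lt_trans; [exact Hback |].
    apply (Rmult_lt_compat_l b) in Hvb; auto.
    replace (b * (r1 / b)) with r1 in Hvb by (field; lra); exact Hvb. }
  assert (Hz : v = zero -> T y = zero)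
    by (intros Hvz; rewrite E1, Hvz; now apply backward_zero).
  unfold lyapunov_surrogate; fold v.
  destruct (excluded_middle_informative (collinear y (T y) v)) as [Hcol | Hncol].
  (* A vanishing determinant leaves only [v = zero], and the backward orbit of
     the origin is constant. *)
  - assert (Hv0 : v = zero).
    { apply collinear_cross in Hcol.
      rewrite E0 in Hcol at 1; rewrite backward_minus, E1, backward_minus in Hcol.
      specialize (Hcross v Hvd1); rewrite Hcol, Rabs_R0 in Hcross.
      refine (norm_eq_zero v _).
      destruct (Req_dec (norm v) 0) as [h | h]; [exact h |].
      pose proof (pow2_gt_0 (norm v) h); nra. }
    rewrite (Hz Hv0); refine (Rle_trans _ 0 _ (Req_le _ _ norm_zero) _).
    apply Rmult_le_pos; [lra | apply pow2_ge_0].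
  - assert (Hsp : surrogate_point y (T y) v
                    (epsilon (inhabits zero) (surrogate_point y (T y) v))).
    { apply epsilon_spec; destruct (surrogate_point_unique y (T y) v Hncol)
        as (u & Hsu & _); now exists u. }
    set (u := epsilon _ _) in *.
    assert (Hv0 : v <> zero).
    { intros Hvz; apply Hncol.
      exists zero, (1, 0); split.
      { intros E; apply (f_equal fst) in E; change (1 = 0) in E; lra. }
      assert (Z : zero = plus zero (scal 0 (1, 0 : R)) :> R * R).
      { change ((0, 0) = (0 + 0 * 1, 0 + 0 * 0) :> R * R); f_equal; ring. }
      assert (Hy0' : y = zero)
        by (rewrite E0, (Hz Hvz); now apply backward_zero).
      rewrite (Hz Hvz), Hvz, Hy0'; repeat split; exists 0; exact Z. }
    apply Rle_trans with (K * norm v ^ 2);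
      [apply Hu; auto; rewrite <- E1, <- E0; exact Hsp |].
    apply Rmult_le_compat_l; [lra |].
    apply pow_incr; split; [apply norm_ge_0 | exact Hv].
Qed.

Lemma halving_converges {V : NormedModule R_AbsRing} (y : nat -> V) :
  (forall n, norm (y (S n)) <= 1 / 2 * norm (y n)) ->
  filterlim y eventually (locally (zero : V)).
Proof.
  intros H; apply filterlim_norm_zero.
  assert (G : forall n, norm (y n) <= norm (y 0%nat) * (1 / 2) ^ n).
  { induction n as [| n IH]; [simpl; lra |].
    eapply Rle_trans; [apply H |]; simpl; lra. }
  apply (is_lim_seq_le_le (fun _ => 0) (fun n => norm (y n))
           (fun n => norm (y 0%nat) * (1 / 2) ^ n) 0).
  - intros n; split; [apply norm_ge_0 | apply G].
  - apply is_lim_seq_const.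
  - replace (Finite 0) with (Rbar_mult (norm (y 0%nat)) 0)
      by (simpl; f_equal; ring).
    apply is_lim_seq_scal_l, is_lim_seq_geom; rewrite Rabs_pos_eq; lra.
Qed.

Theorem theorem3 :
  forall (f : R -> R) (PA PB : R * R -> R * R) (r0 eta r1 : R),
  real_analytic f ->
  f 0 = 0 ->
  Derive f 0 <> 0 ->
  nearest_selector x_axis PA ->
  nearest_selector (graph f) PB ->
  let T := douglas_rachford PA PB in
  0 < r0 ->
  1 < eta ->
  (forall y : R * R, norm y < r0 -> norm y >= eta * norm (T (T y))) ->
  0 < r1 ->
  (forall (y : R * R) (x z : R), T y = (x, z) -> Rabs x < r1 ->
     y = (x + z * Derive f x, z - f x)) ->
  exists r2 r3 : R, 0 < r2 /\ 0 < r3 /\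
    forall y : nat -> R * R,
      norm (y 0%nat) < Rmin (Rmin r0 r1) (Rmin r2 r3) ->
      (forall n : nat, y (S n) = lyapunov_surrogate T (y n)) ->
      filterlim y eventually (locally (zero : R * R)) /\
      (forall n : nat, norm (y (S n)) <= 1 / 2 * norm (y n)) /\
      (exists (K : R) (N : nat), 0 < K /\
         forall n : nat, (N <= n)%nat -> norm (y (S n)) <= K * norm (y n) ^ 2).
Proof.
  intros f PA PB r0 eta r1 Hf f0 Hm _ _ T Hr0 Heta Hdec Hr1 Hinv.
  destruct (lyapunov_surrogate_quadratic f T r0 r1) as (K & r2 & HK & Hr2 & HL);
    auto.
  { intros y Hy; specialize (Hdec y Hy); pose proof (norm_ge_0 (T (T y))); nra. }
  { intros y; apply Hinv, surjective_pairing. }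
  exists r2, (/ (2 * K)); split; [exact Hr2 |].
  split; [apply Rinv_0_lt_compat; lra |]; intros y Hy0 Hy.
  apply Rmin_Rgt in Hy0; destruct Hy0 as [Ha Hb].
  apply Rmin_Rgt in Ha; destruct Ha as [Ha _].
  apply Rmin_Rgt in Hb; destruct Hb as [Hb Hc]; apply Rgt_lt in Ha, Hb, Hc.
  assert (Hhalf : forall v : R * R, norm v < / (2 * K) ->
            K * norm v ^ 2 <= 1 / 2 * norm v).
  { intros v Hv; apply (Rmult_lt_compat_l K) in Hv; auto.
    replace (K * / (2 * K)) with (1 / 2) in Hv by (field; lra).
    pose proof (norm_ge_0 v); nra. }
  assert (Hin : forall n, norm (y n) <= norm (y 0%nat)).
  { induction n as [| n IH]; [lra |]; rewrite Hy.
    eapply Rle_trans; [apply HL; lra |].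
    eapply Rle_trans; [apply Hhalf; lra |].
    pose proof (norm_ge_0 (y n)); lra. }
  assert (Hquad : forall n, norm (y (S n)) <= K * norm (y n) ^ 2)
    by (intros n; rewrite Hy; specialize (Hin n); apply HL; lra).
  assert (Hlin : forall n, norm (y (S n)) <= 1 / 2 * norm (y n)).
  { intros n; eapply Rle_trans; [apply Hquad |].
    specialize (Hin n); apply Hhalf; lra. }
  split.
  { apply (halving_converges
      (V := prod_NormedModule R_AbsRing R_NormedModule R_NormedModule) y Hlin). }
  split; [exact Hlin |].
  exists K, 0%nat; auto.
Qed.
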